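(* Let $H$ be a Hilbert space over $\mathbb{R}$ or $\mathbb{C}$, let $[a,b]$ be a compact real interval, and let $\Delta := \{(t,s)\in\mathbb{R}^2 : a\le t\le s\le b\}$. Let $f\in L([a,b];H)$ and $\gamma,\Gamma\in\mathbb{R}$ be such that either $$\operatorname{Re}\langle \Gamma f(s)-f(t),\, f(t)-\gamma f(s)\rangle \ge 0\quad\text{for a.e. }(t,s)\in\Delta, \qquad (1)$$ or, equivalently, $$\left\|f(t)-\frac{\Gamma+\gamma}{2}f(s)\right\| \le \frac12|\Gamma-\gamma|\,\|f(s)\|\quad\text{for a.e. }(t,s)\in\Delta. \qquad (2)$$ Then $$\int_a^b\big[(b-s)+\gamma\Gamma(s-a)\big]\|f(s)\|^2\,ds \le \frac{\Gamma+\gamma}{2}\left\|\int_a^b f(s)\,ds\right\|^2. \qquad (3)$$ Equality holds in (3) if and only if equality holds in either (1) or (2) for a.e. $(t,s)\in\Delta$.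
   Context: $L([a,b];H)$ denotes the space of Bochner integrable functions on $[a,b]$ (with Lebesgue measure) with values in the Hilbert space $H$. $\langle\cdot,\cdot\rangle$ is the inner product of $H$ and $\|\cdot\|$ its norm. ''For a.e. $(t,s)\in\Delta$'' refers to two-dimensional Lebesgue measure. The integral on the left of (3) is understood in the extended sense (positive part minus negative part), so that it may take an infinite value if the integrand is not Lebesgue integrable. *)

(* Defs.v *)
From HB Require Import structures.
From mathcomp Require Export all_boot all_order all_algebra.
From mathcomp Require Export all_classical all_reals all_analysis.
From mathcomp Require Export complex.
Export Order.TTheory GRing.Theory Num.Theory.
Export numFieldNormedType.Exports.

Set Implicit Arguments.
Unset Strict Implicit.
Unset Printing Implicit Defensive.

Global Open Scope classical_set_scope.
Global Open Scope ring_scope.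

Variant scalar_kind := RealScalars | ComplexScalars.

Definition scalar (R : realType) (k : scalar_kind) : numFieldType :=
  match k with RealScalars => R | ComplexScalars => R[i] end.

Definition scalar_conj (R : realType) (k : scalar_kind) :
    scalar R k -> scalar R k :=
  match k with RealScalars => idfun | ComplexScalars => Num.conj end.

Definition scalar_re (R : realType) (k : scalar_kind) : scalar R k -> R :=
  match k with RealScalars => id | ComplexScalars => @complex.Re R end.

Definition of_real (R : realType) (k : scalar_kind) : R -> scalar R k :=
  match k with RealScalars => id | ComplexScalars => fun x => x%:C%C end.
Arguments of_real {R} k x.

(* The norm of a normed module takes its values in the scalar field, where it
   is a nonnegative real even if that field is [R[i]]; this is the same number
   as an element of [R]. *)
Definition rnorm (R : realType) (k : scalar_kind)
    (H : normedModType (scalar R k)) (x : H) : R :=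
  scalar_re `|x|.

Section Bochner.
Context {d : measure_display} {T : measurableType d} {R : realType}
  {k : scalar_kind} {H : completeNormedModType (scalar R k)}.
Variables (mu : {measure set T -> \bar R}) (D : set T).

Definition bochner_simple (s : {fimfun T >-> H}) : Prop :=
  (forall v, measurable (s @^-1` [set v])) /\
  (forall v, v != 0 -> (mu (D `&` s @^-1` [set v]) < +oo)%E).

(* If [D] has infinite measure, [fine] yields the harmless summand [0 *: 0]
   for the value [v = 0]. *)
Definition bochner_sintegral (s : {fimfun T >-> H}) : H :=
  \sum_(v \in range s) of_real k (fine (mu (D `&` s @^-1` [set v]))) *: v.

(* For a complete measure, the almost everywhere convergence makes the
   integrands [rnorm (f x - s n x)] measurable on a measurable [D]. *)
Definition bochner_approx (f : T -> H) (s : nat -> {fimfun T >-> H}) : Prop :=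
  [/\ forall n, bochner_simple (s n),
      {ae mu, forall x, D x -> s n x @[n --> \oo] --> f x} &
      (\int[mu]_(x in D) (rnorm (f x - s n x))%:E)%E @[n --> \oo] --> 0%E].

Definition bochner_integrable (f : T -> H) : Prop :=
  exists s, bochner_approx f s.

(* The limit depends neither on the approximating sequence nor on [get]. *)
Definition bochner_integral (f : T -> H) : H :=
  get [set v | exists2 s, bochner_approx f s &
                 bochner_sintegral (s n) @[n --> \oo] --> v].

End Bochner.

(* Lebesgue measure on the sigma-algebra of all Lebesgue measurable sets, not
   only on the Borel sets. *)
Notation leb := completed_lebesgue_measure.

(* [leb \x leb] lives on the product of two Lebesgue sigma-algebras; its
   negligible sets are those of the two-dimensional Lebesgue measure. *)
Notation leb2 := (leb \x leb)%E.

Definition Delta (R : realType) (a b : R) : set (R * R) :=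
  [set p | a <= p.1 /\ p.1 <= p.2 /\ p.2 <= b].

(* Main.v *)
Require Import Defs.
From mathcomp Require Import measurable_realfun ring lra.

(* Expanding the inner product, the quantity in (1) is
   (Gamma + gamma) Re <f s, f t> - gamma Gamma |f s|^2 - |f t|^2, and it equals
   the difference of the squares of the two sides of (2). Integrate it over
   Delta: the kernel Re <f s, f t> is symmetric, so its integral over Delta is
   half its integral over the square, that is half of the squared norm of the
   integral of f, while the two other terms give the left-hand side of (3) by
   Tonelli. This is legitimate although f is only integrable: (2) yields
   |f t| <= K |f s| on Delta, so that |f t|^2 is dominated there by the
   integrable K |f t| |f s|. The only term that may fail to be integrable is
   gamma Gamma |f s|^2; then gamma Gamma < 0, the left-hand side of (3) is -oo,
   and equality cannot hold in (1), which would dominate |f s|^2. *)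

Set Implicit Arguments.
Unset Strict Implicit.
Unset Printing Implicit Defensive.
Set SsrOldRewriteGoalsOrder.

(** * Real parts and norms over both kinds of scalars *)

Lemma cvg_norm_le (R : realType) (u e : nat -> R) (l : R) :
  (\forall n \near \oo, `|u n - l| <= e n) -> e n @[n --> \oo] --> 0 ->
  u n @[n --> \oo] --> l.
Proof.
move=> ue e0; apply/subr_cvg0/norm_cvg0P; apply: squeeze_cvgr (cvg_cst 0) e0.
by near=> n; rewrite normr_ge0/=; near: n.
Unshelve. all: by end_near. Qed.

Section scalars.
Context {R : realType} {k : scalar_kind}.
Implicit Types (x y : R) (z w : scalar R k).

Lemma scalar_reD z w : scalar_re (z + w) = scalar_re z + scalar_re w.
Proof. by case: k z w => //= -[? ?] [? ?]. Qed.

Lemma scalar_reN z : scalar_re (- z) = - scalar_re z.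
Proof. by case: k z => //= -[]. Qed.

Lemma scalar_re_of_realM x z : scalar_re (of_real k x * z) = x * scalar_re z.
Proof. by case: k z => //= -[? ?] /=; rewrite mul0r subr0. Qed.

Lemma scalar_re_of_real x : scalar_re (of_real k x) = x.
Proof. by case: k. Qed.

Lemma scalar_re_conj z : scalar_re (scalar_conj z) = scalar_re z.
Proof. by case: k z => //= -[]. Qed.

Lemma of_real_scalar_re z : 0 <= z -> of_real k (scalar_re z) = z.
Proof. by case: k z => //= -[u v]/=; rewrite lecE/= => /andP[/eqP-> _]. Qed.

Lemma ler_of_real x y : (of_real k x <= of_real k y) = (x <= y).
Proof. by case: k => //=; rewrite lecR. Qed.

Lemma ltr_of_real x y : (of_real k x < of_real k y) = (x < y).
Proof. by case: k => //=; rewrite ltcR. Qed.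

Lemma of_realD x y : of_real k (x + y) = of_real k x + of_real k y.
Proof. by case: k => //=; rewrite rmorphD. Qed.

Lemma of_realM x y : of_real k (x * y) = of_real k x * of_real k y.
Proof. by case: k => //=; rewrite rmorphM. Qed.

Lemma of_real0 : of_real k 0 = 0 :> scalar R k.
Proof. by case: k. Qed.

Lemma normr_of_real x : `|of_real k x| = of_real k `|x|.
Proof. by case: k => //=; rewrite normc_def /= expr0n addr0 sqrtr_sqr. Qed.

End scalars.

Section rnorm.
Context {R : realType} {k : scalar_kind} {H : normedModType (scalar R k)}.
Implicit Types x y : H.

Lemma of_real_rnorm x : of_real k (rnorm x) = `|x|.
Proof. exact/of_real_scalar_re. Qed.

Lemma rnorm_ge0 x : 0 <= rnorm x.
Proof. by rewrite -(@ler_of_real R k) of_real_rnorm of_real0. Qed.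

Lemma rnorm0 : rnorm (0 : H) = 0.
Proof. by rewrite /rnorm normr0 -(@of_real0 R k) scalar_re_of_real. Qed.

Lemma rnormN x : rnorm (- x) = rnorm x.
Proof. by rewrite /rnorm normrN. Qed.

Lemma rnormB x y : rnorm (x - y) = rnorm (y - x).
Proof. by rewrite -rnormN opprB. Qed.

Lemma rnormZ (c : R) x : rnorm (of_real k c *: x) = `|c| * rnorm x.
Proof. by rewrite /rnorm normrZ normr_of_real scalar_re_of_realM. Qed.

Lemma ler_rnormD x y : rnorm (x + y) <= rnorm x + rnorm y.
Proof.
by rewrite -(@ler_of_real R k) of_realD !of_real_rnorm ler_normD.
Qed.

Lemma ler_dist_rnorm x y : `|rnorm x - rnorm y| <= rnorm (x - y).
Proof.
have := ler_rnormD (y - x) x; have := ler_rnormD (x - y) y.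
by rewrite !subrK (rnormB y) ler_distl => ? ?; apply/andP; split; lra.
Qed.

(** Scalar radii are matched with real ones: a positive element of [R[i]] has zero imaginary part,
    so [of_real] and [scalar_re] translate between the two. *)
Lemma rnorm_cvgP (u : nat -> H) x :
  u n @[n --> \oo] --> x <-> rnorm (u n - x) @[n --> \oo] --> (0 : R).
Proof.
split=> [/cvgrPdist_lt ux|/cvgrPdist_lt ux].
- apply/cvgrPdist_lt => e e0.
  have ke0 : 0 < of_real k e by rewrite -(@of_real0 R k) ltr_of_real.
  near=> n; rewrite sub0r normrN ger0_norm ?rnorm_ge0// rnormB.
  by rewrite -(@ltr_of_real R k) of_real_rnorm; near: n; exact: ux.
- apply/cvgrPdist_lt => e e0.
  have ee := of_real_scalar_re (ltW e0).
  have re0 : 0 < scalar_re e by rewrite -(@ltr_of_real R k) ee of_real0.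
  near=> n; rewrite -of_real_rnorm -ee ltr_of_real rnormB.
  rewrite -[ltLHS]ger0_norm ?rnorm_ge0// -normrN -[- _]add0r.
  by near: n; exact: ux.
Unshelve. all: by end_near. Qed.

End rnorm.

(** * The real part of the inner product *)

Section re_dot.
Context {R : realType} {k : scalar_kind} {H : normedModType (scalar R k)}.
Variables (ip : {dot H for @scalar_conj R k}).
Hypothesis ip_norm : forall x : H, ip x x = `|x| ^+ 2.
Implicit Types x y v : H.

(** Taking real parts turns the Hermitian form into a symmetric real-bilinear one, which treats both
    kinds of scalars at once. *)
Definition re_dot x y : R := scalar_re (ip x y).

Lemma re_dotDl x y v : re_dot (x + y) v = re_dot x v + re_dot y v.
Proof. by rewrite /re_dot linearDl scalar_reD. Qed.

Lemma re_dotC x y : re_dot x y = re_dot y x.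
Proof.
by rewrite /re_dot (hermitian_subproof (s := ip) x) expr0 mul1r scalar_re_conj.
Qed.

Lemma re_dotDr x y v : re_dot v (x + y) = re_dot v x + re_dot v y.
Proof. by rewrite !(re_dotC v) re_dotDl. Qed.

Lemma re_dotZl (c : R) x y : re_dot (of_real k c *: x) y = c * re_dot x y.
Proof. by rewrite /re_dot linearZl_LR scalar_re_of_realM. Qed.

Lemma re_dotZr (c : R) x y : re_dot x (of_real k c *: y) = c * re_dot x y.
Proof. by rewrite re_dotC re_dotZl re_dotC. Qed.

Lemma re_dotNl x y : re_dot (- x) y = - re_dot x y.
Proof. by rewrite /re_dot linearNl scalar_reN. Qed.

Lemma re_dotNr x y : re_dot x (- y) = - re_dot x y.
Proof. by rewrite re_dotC re_dotNl re_dotC. Qed.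

Lemma re_dot0r x : re_dot x 0 = 0.
Proof. by rewrite -(subrr 0) re_dotDr re_dotNr subrr. Qed.

Lemma re_dotxx x : re_dot x x = rnorm x ^+ 2.
Proof.
by rewrite /re_dot ip_norm -of_real_rnorm expr2 -of_realM scalar_re_of_real.
Qed.

(* Cauchy-Schwarz is the square of the triangle inequality for the norm. *)
Lemma ler_re_dot x y : re_dot x y <= rnorm x * rnorm y.
Proof.
have : rnorm (x + y) ^+ 2 <= (rnorm x + rnorm y) ^+ 2.
  by rewrite lerXn2r ?nnegrE ?addr_ge0 ?rnorm_ge0// ler_rnormD.
rewrite -re_dotxx re_dotDl !re_dotDr (re_dotC y x) !re_dotxx; lra.
Qed.

Lemma normr_re_dot x y : `|re_dot x y| <= rnorm x * rnorm y.
Proof.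
by rewrite ler_norml ler_re_dot lerNl -re_dotNl -(rnormN x) ler_re_dot.
Qed.

Lemma re_dot_cvg (u v : nat -> H) x y :
  u n @[n --> \oo] --> x -> v n @[n --> \oo] --> y ->
  re_dot (u n) (v n) @[n --> \oo] --> re_dot x y.
Proof.
move=> /rnorm_cvgP ux /rnorm_cvgP vy.
(* Expanding both arguments around their limits leaves three terms; each summand of [e] is the
   Cauchy-Schwarz bound of one of them. *)
pose e n := rnorm (u n - x) * rnorm (v n - y) + rnorm (u n - x) * rnorm y
            + rnorm x * rnorm (v n - y).
apply: (@cvg_norm_le _ _ e); first apply: nearW => n.
  have -> : re_dot (u n) (v n) - re_dot x y = re_dot (u n - x) (v n - y)
      + re_dot (u n - x) y + re_dot x (v n - y).
    by rewrite !(re_dotDl, re_dotDr, re_dotNl, re_dotNr); lra.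
  apply: le_trans (ler_normD _ _) _; apply: lerD; last exact: normr_re_dot.
  by apply: le_trans (ler_normD _ _) _; apply: lerD; exact: normr_re_dot.
rewrite -[X in _ --> X](_ : 0 * 0 + 0 * rnorm y + rnorm x * 0 = 0 :> R);
  last first.
  by rewrite !mul0r mulr0 !addr0.
by apply: cvgD; [apply: cvgD|]; apply: cvgM => //; exact: cvg_cst.
Qed.

End re_dot.

(** * Strong measurability *)

Section finite_measurable.
Context {d : measure_display} {T : measurableType d}.

(** The target carries no sigma-algebra, so that vectors, booleans and reals are handled
    together. *)
Definition simple_meas (U : Type) (phi : T -> U) : Prop :=
  finite_set (range phi) /\ forall v, measurable (phi @^-1` [set v]).

Lemma simple_meas_preimage (U : choiceType) (phi : T -> U) (B : set U) :
  simple_meas phi -> measurable (phi @^-1` B).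
Proof.
move=> [fphi mphi].
have -> : phi @^-1` B = \bigcup_(v in range phi `&` B) phi @^-1` [set v].
  apply/seteqP; split=> [x Bx|x [v [_ Bv] /= ->]]//.
  by exists (phi x) => //; split => //; exists x.
by apply: fin_bigcup_measurable => //; exact: finite_setIl.
Qed.

(** A level set of the result is a finite union, over the values [u] of [phi], of sets where [phi]
    is [u] and [psi] lies in a slice of [op]. *)
Lemma simple_meas_op (U V W : choiceType) (op : U -> V -> W) (phi : T -> U)
    (psi : T -> V) :
  simple_meas phi -> simple_meas psi ->
  simple_meas (fun x => op (phi x) (psi x)).
Proof.
move=> [fphi mphi] mpsi; split.
  apply: (@sub_finite_set _ _ [set op u v | u in range phi & v in range psi]).
    by move=> _ [x _ <-]; exists (phi x) => //; exists (psi x) => //; exists x.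
  by apply: finite_image2 => //; case: mpsi.
move=> w; have -> : (fun x => op (phi x) (psi x)) @^-1` [set w] =
    \bigcup_(u in range phi)
      (phi @^-1` [set u] `&` psi @^-1` [set v | op u v = w]).
  apply/seteqP; split=> [x xw|x [u _ [/= -> ->]]]//.
  by exists (phi x).
apply: fin_bigcup_measurable => // u _; apply: measurableI => //.
exact: simple_meas_preimage.
Qed.

Lemma simple_meas_measurable (R : realType) (phi : T -> R) :
  simple_meas phi -> measurable_fun setT phi.
Proof. by move=> fphi _ B _; rewrite setTI; exact: simple_meas_preimage. Qed.

Lemma simple_meas_restrict (U : choiceType) (u0 : U) (phi : T -> U)
    (E : set T) :
  measurable E -> simple_meas phi ->
  simple_meas (fun x => if x \in E then phi x else u0).
Proof.
move=> mE fphi.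
(* Cutting off outside [E] is a binary operation on [phi] and the boolean indicator of [E]. *)
apply: (@simple_meas_op U bool U (fun u b => if b then u else u0)) => //; split.
  exact: (@finite_finset bool).
move=> [].
  rewrite (_ : _ @^-1` _ = E)//.
  by apply/seteqP; split=> x /=; [move=> /set_mem|move=> /mem_set].
rewrite (_ : _ @^-1` _ = ~` E); first exact: measurableC.
apply/seteqP; split=> x /=; first by move/negbT/negP => xE /mem_set.
by move=> xE; apply/negbTE/negP => /set_mem.
Qed.

End finite_measurable.

Lemma simple_meas_comp (d d' : measure_display) (T : measurableType d)
    (T' : measurableType d') (U : Type) (phi : T -> U) (h : T' -> T) :
  measurable_fun setT h -> simple_meas phi -> simple_meas (phi \o h).
Proof.
move=> mh [fphi mphi]; split.
  by apply: sub_finite_set fphi => _ [x _ <-]; exists (h x).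
by move=> v; rewrite comp_preimage -[X in measurable X]setTI; exact: mh.
Qed.

Section strongly_measurable.
Context {d : measure_display} {T : measurableType d} {R : realType}
  {k : scalar_kind} {H : normedModType (scalar R k)}.

(** Convergence at every point, rather than almost everywhere, makes the notion stable under
    composition with any measurable map, in particular with the projections of a product. *)
Definition strong_meas (f : T -> H) : Prop :=
  exists2 phi : nat -> T -> H, (forall n, simple_meas (phi n)) &
    forall x, phi n x @[n --> \oo] --> f x.

Lemma simple_meas_strong_meas (f : T -> H) : simple_meas f -> strong_meas f.
Proof. by move=> fm; exists (fun=> f) => // x; exact: cvg_cst. Qed.

Lemma strong_measB (f g : T -> H) :
  strong_meas f -> strong_meas g -> strong_meas (fun x => f x - g x).
Proof.
move=> [phi mphi phif] [psi mpsi psig].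
exists (fun n x => phi n x - psi n x) => [n|x]; last exact: cvgB.
exact: (@simple_meas_op _ _ _ _ _ (fun u v => u - v)).
Qed.

Lemma strong_meas_rnorm (f : T -> H) :
  strong_meas f -> measurable_fun setT (fun x => rnorm (f x)).
Proof.
move=> [phi mphi phif].
apply: (@measurable_fun_cvg _ _ _ _ (fun n x => rnorm (phi n x))).
- move=> n; apply: simple_meas_measurable.
  exact: (@simple_meas_op _ _ _ _ _ (fun u _ => rnorm u) _ (phi n)).
- move=> x _; apply: (@cvg_norm_le _ _ (fun n => rnorm (phi n x - f x))).
    by apply: nearW => n; exact: ler_dist_rnorm.
  exact/rnorm_cvgP.
Qed.

Lemma strong_meas_re_dot (ip : {dot H for @scalar_conj R k})
    (ip_norm : forall x : H, ip x x = `|x| ^+ 2) (f g : T -> H) :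
  strong_meas f -> strong_meas g ->
  measurable_fun setT (fun x => re_dot ip (f x) (g x)).
Proof.
move=> [phi mphi phif] [psi mpsi psig].
apply: (@measurable_fun_cvg _ _ _ _ (fun n x => re_dot ip (phi n x) (psi n x))).
- move=> n; apply: simple_meas_measurable.
  exact: (@simple_meas_op _ _ _ _ _ (fun u v => re_dot ip u v)).
- by move=> x _; apply: re_dot_cvg.
Qed.

End strongly_measurable.

Lemma strong_meas_comp (d d' : measure_display) (T : measurableType d)
    (T' : measurableType d') (R : realType) (k : scalar_kind)
    (H : normedModType (scalar R k)) (f : T -> H) (h : T' -> T) :
  measurable_fun setT h -> strong_meas f -> strong_meas (f \o h).
Proof.
move=> mh [phi mphi phif]; exists (fun n => phi n \o h) => [n|x].
  exact: simple_meas_comp.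
exact: phif.
Qed.

(** * The Bochner integral tested against vectors *)

Section bochner.
Context {d : measure_display} {T : measurableType d} {R : realType}
  {k : scalar_kind} {H : completeNormedModType (scalar R k)}.
Variables (ip : {dot H for @scalar_conj R k}).
Hypothesis ip_norm : forall x : H, ip x x = `|x| ^+ 2.
Variables (mu : {measure set T -> \bar R}) (D : set T).
Hypotheses (mD : measurable D) (D_fin : (mu D < +oo)%E).
Local Notation "'q(' x , y )" := (re_dot ip x y).

Lemma bochner_simple_simple_meas (s : {fimfun T >-> H}) :
  bochner_simple mu D s -> simple_meas s.
Proof. by move=> [ms _]; split. Qed.

Lemma re_dot_sumr (I : Type) (r : seq I) (F : I -> H) v :
  q(v, \sum_(i <- r) F i) = \sum_(i <- r) q(v, F i).
Proof.
exact: (big_morph (re_dot ip v) (fun x y => re_dotDr ip x y v) (re_dot0r ip v)).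
Qed.

(** [D] splits into the finitely many level sets of [s], and the pairing is constant on each of
    them. *)
Lemma bochner_sintegral_re_dot (s : {fimfun T >-> H}) v :
  bochner_simple mu D s ->
  (\int[mu]_(x in D) (q(v, s x))%:E)%E = (q(v, bochner_sintegral mu D s))%:E.
Proof.
move=> ms; have fs := bochner_simple_simple_meas ms.
pose F (w : H) := D `&` s @^-1` [set w].
have mF w : measurable (F w) by apply: measurableI => //; case: ms.
have DE : D = \big[setU/set0]_(w <- finmap.enum_fset (fset_set (range s))) F w.
  rewrite bigsetU_fset_set//; apply/seteqP; split=> [x Dx|x [w _ []]//].
  by exists (s x) => //; exists x.
have mq : measurable_fun setT (fun x => q(v, s x)).
  apply: simple_meas_measurable.
  exact: (@simple_meas_op _ _ _ _ _ (fun u _ => q(v, u)) _ s).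
rewrite {1}DE integral_bigsetU_EFin//=; last 2 first.
- apply/trivIsetP => w1 w2 _ _ w12; rewrite -subset0 => x [[_ /= e1] [_ /= e2]].
  by move: w12; rewrite -e1 -e2 eqxx.
- by apply/measurable_EFinP; apply: measurable_funS mq.
rewrite /bochner_sintegral fsbig_finite//= re_dot_sumr -sumEFin.
apply: eq_bigr => w _; rewrite re_dotZr.
rewrite (eq_integral (cst (q(v, w))%:E)); last first.
  by move=> x; rewrite inE => -[_ /= ->].
rewrite integral_cst//= muleC EFinM fineK//.
(* The finite measure of [D] also covers the level set of 0, whose measure [bochner_simple] does not
   bound. *)
rewrite ge0_fin_numE//; apply: le_lt_trans D_fin.
by apply: le_measure; rewrite ?inE; [exact: (mF w)|exact: mD|move=> x []].
Qed.

(** The simple functions converge to [f] only almost everywhere on [D]. Putting 0 on a null set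
    containing the exceptional points and outside [D], both in [f] and in the simple functions,
    gives convergence everywhere. *)
Lemma bochner_regularize (f : T -> H) s :
  bochner_approx mu D f s ->
  exists g : T -> H, [/\ strong_meas g, forall x, ~ D x -> g x = 0 &
    {ae mu, forall x, D x -> f x = g x}].
Proof.
move=> [ms [N [mN N0 sN]] _].
pose E := D `\` N; have mE : measurable E by exact: measurableD.
have sE x : E x -> s n x @[n --> \oo] --> f x.
  move=> [Dx Nx]; apply: contrapT => sx; apply: Nx; apply: sN => /= /(_ Dx).
  exact: sx.
exists (fun x => if x \in E then f x else 0); split.
- exists (fun n x => if x \in E then s n x else 0) => [n|x].
    exact/simple_meas_restrict/bochner_simple_simple_meas.
  by case: ifPn => [/set_mem /sE//|_]; exact: cvg_cst.
- by move=> x Dx; case: ifPn => // /set_mem [].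
- exists N; split => // x /= /not_implyP[Dx]; case: ifPn => // xE _.
  by apply: contrapT => Nx; move/negP : xE; apply; exact/mem_set.
Qed.

Section regularized.
Hypothesis cmu : measure_is_complete mu.
Variables (f g : T -> H) (s : nat -> {fimfun T >-> H}).
Hypotheses (fs : bochner_approx mu D f s) (mg : strong_meas g)
  (g0 : forall x, ~ D x -> g x = 0)
  (fg : {ae mu, forall x, D x -> f x = g x}).

Let err n := (\int[mu]_(x in D) (rnorm (g x - s n x))%:E)%E.

Let ms n : strong_meas (s n).
Proof.
by apply: simple_meas_strong_meas; apply: bochner_simple_simple_meas; case: fs.
Qed.

Let merr n : measurable_fun setT (fun x => rnorm (g x - s n x)).
Proof. exact/strong_meas_rnorm/strong_measB. Qed.

(** The errors are given for [f]. Their integrands agree almost everywhere on [D] with those for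
    [g], so completeness of [mu] makes them measurable and the integrals coincide. *)
Let err_cvg : err n @[n --> \oo] --> 0%E.
Proof.
have err_f : (fun n => \int[mu]_(x in D) (rnorm (f x - s n x))%:E)%E = err.
  apply/funext => n.
  have eq_fg : ae_eq mu D (fun x => (rnorm (g x - s n x))%:E)
                          (fun x => (rnorm (f x - s n x))%:E).
    by apply: filterS fg => x + Dx => /(_ Dx) ->.
  have mgs : measurable_fun D (fun x => (rnorm (g x - s n x))%:E).
    by apply/measurable_EFinP; apply: measurable_funS (merr n).
  apply: ae_eq_integral => //; last exact: ae_eq_sym.
  exact: (ae_measurable_fun cmu eq_fg).
by case: fs => _ _; rewrite err_f.
Qed.

Let err_fin : \forall n \near \oo, (err n < +oo)%E.
Proof.
have [efin _] := (fine_cvgP _ _).1 err_cvg.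
by apply: filterS efin => n /fin_numPlt/andP[].
Qed.

Let bounded_s n : exists M : R, forall x, rnorm (s n x) <= M.
Proof.
exists (\sum_(w <- finmap.enum_fset (fset_set (range (s n)))) rnorm w) => x.
have xs : s n x \in finmap.enum_fset (fset_set (range (s n))).
  by rewrite in_fset_set// inE; exists x.
rewrite (big_rem _ xs)/= lerDl; apply: sumr_ge0 => w _; exact: rnorm_ge0.
Qed.

Let int_s n : mu.-integrable D (EFin \o (fun x => rnorm (s n x))).
Proof.
have [M sM] := bounded_s n.
apply: (@le_integrable _ _ _ mu D mD _ (cst M%:E)).
- by apply/measurable_EFinP; apply: measurable_funS (strong_meas_rnorm (ms n)).
- move=> x _ /=; rewrite lee_fin ger0_norm ?rnorm_ge0//.
  by apply: le_trans (sM x) _; exact: ler_norm.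
- apply/integrableP; split => //.
  by rewrite integral_cst//= lte_mul_pinfty.
Qed.

Let int_err n : (err n < +oo)%E ->
  mu.-integrable D (EFin \o (fun x => rnorm (g x - s n x))).
Proof.
move=> en; apply/integrableP; split.
  by apply/measurable_EFinP; apply: measurable_funS (merr n).
rewrite (eq_integral (fun x => (rnorm (g x - s n x))%:E))// => x _ /=.
by rewrite ger0_norm ?rnorm_ge0.
Qed.

(** One index with finite error suffices: [g] is an integrable error plus a bounded function on a
    set of finite measure. *)
Let int_g : mu.-integrable D (EFin \o (fun x => rnorm (g x))).
Proof.
have [n en] : exists n, (err n < +oo)%E.
  by case: err_fin => N _ /(_ N (leqnn N)); exists N.
apply: (le_integrable mD _ _ (integrableD mD (int_err en) (int_s n))).
  by apply/measurable_EFinP; apply: measurable_funS (strong_meas_rnorm mg).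
move=> x _ /=; rewrite lee_fin !ger0_norm ?addr_ge0 ?rnorm_ge0//.
by rewrite -{1}(subrK (s n x) (g x)) ler_rnormD.
Qed.

Let int_q (h : T -> H) v : strong_meas h ->
  mu.-integrable D (EFin \o (fun x => rnorm (h x))) ->
  mu.-integrable D (EFin \o (fun x => q(v, h x))).
Proof.
move=> mh ih; apply: (le_integrable mD _ _ (integrableZl mD (rnorm v) ih)).
  apply/measurable_EFinP; apply: (@measurable_funS _ _ _ _ setT) => //.
  apply: strong_meas_re_dot => //; apply: simple_meas_strong_meas; split=> [|w].
    by apply: (@sub_finite_set _ _ [set v]) => // _ [x _ <-].
  by rewrite preimage_cst; case: ifP.
move=> x _ /=; rewrite lee_fin [leRHS]ger0_norm ?mulr_ge0 ?rnorm_ge0//.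
exact: normr_re_dot.
Qed.

(** The pairing passes through the integral of the simple function; what remains is the integral of
    [q(v, g x - s n x)], where Cauchy-Schwarz applies under the integral sign. *)
Let sintegral_dist v n : (err n < +oo)%E ->
  `|q(v, bochner_sintegral mu D (s n)) - \int[mu]_(x in D) q(v, g x)|
    <= rnorm v * fine (err n).
Proof.
move=> en.
have -> : q(v, bochner_sintegral mu D (s n)) = \int[mu]_(x in D) q(v, s n x).
  by rewrite /Rintegral bochner_sintegral_re_dot//; case: fs.
have igs : mu.-integrable D (EFin \o (fun x => q(v, g x - s n x))).
  exact: int_q (strong_measB mg (ms n)) (int_err en).
have qB x : q(v, g x) - q(v, s n x) = q(v, g x - s n x).
  by rewrite re_dotDr re_dotNr.
rewrite distrC -RintegralB//; [|exact: int_q|exact: int_q].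
under eq_Rintegral do rewrite qB.
apply: le_trans (le_normr_Rintegral mD igs) _.
rewrite -RintegralZl//; last exact: int_err.
apply: le_Rintegral => //.
- by apply: eq_integrable (integrable_abse igs).
- by apply: eq_integrable (integrableZl mD (rnorm v) (int_err en)).
- by move=> x _; exact: normr_re_dot.
Qed.

Lemma integrable_re_dot_regularized v :
  mu.-integrable D (EFin \o (fun x => q(v, g x))).
Proof. exact: int_q. Qed.

Lemma bochner_sintegral_cvg_re_dot v :
  q(v, bochner_sintegral mu D (s n)) @[n --> \oo] -->
  \int[mu]_(x in D) q(v, g x).
Proof.
apply: (@cvg_norm_le _ _ (fun n => rnorm v * fine (err n))).
  by apply: filterS err_fin => n; exact: sintegral_dist.
rewrite -(mulr0 (rnorm v)); apply: cvgM; first exact: cvg_cst.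
exact: ((fine_cvgP _ _).1 err_cvg).2.
Qed.

(* Testing the difference of two integrals against itself reduces the Cauchy
   criterion to the scalar estimate. *)
Lemma is_cvg_bochner_sintegral :
  cvgn (fun n => bochner_sintegral mu D (s n)).
Proof.
apply/cauchy_cvgP; apply: cauchy_exP => eps eps0.
have epsE := of_real_scalar_re (ltW eps0).
have re0 : 0 < scalar_re eps by rewrite -(@ltr_of_real R k) epsE of_real0.
have err_lt : \forall n \near \oo, fine (err n) < scalar_re eps / 2.
  have cv : fine (err n) @[n --> \oo] --> (0 : R).
    exact: ((fine_cvgP _ _).1 err_cvg).2.
  move/cvgrPdist_lt : cv => cv.
  have := cv _ (divr_gt0 re0 (ltr0n R 2)).
  by apply: filterS => n; rewrite sub0r normrN => /(le_lt_trans (ler_norm _)).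
have [N _ errN] := filterI err_fin err_lt.
exists (bochner_sintegral mu D (s N)); exists N => // n Nn.
have [efinN eN] := errN N (leqnn N); have [efinn en] := errN n Nn.
rewrite /= -ball_normE /= -of_real_rnorm -epsE ltr_of_real.
set v := _ - _; have [->//|v0] := eqVneq (rnorm v) 0.
have {}v0 : 0 < rnorm v by rewrite lt_neqAle eq_sym v0 rnorm_ge0.
have := sintegral_dist v efinN; have := sintegral_dist v efinn.
rewrite !ler_distl => /andP[h1 h2] /andP[h3 h4].
have vv : rnorm v ^+ 2 = q(v, bochner_sintegral mu D (s N)) -
    q(v, bochner_sintegral mu D (s n)).
  by rewrite -(re_dotxx ip_norm) {2}/v re_dotDr re_dotNr.
(* Both pairings approximate the integral of [q(v, g x)], each within [rnorm v] times its error;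
   dividing by [rnorm v] then bounds the distance itself. *)
have : rnorm v * rnorm v <= rnorm v * (fine (err N) + fine (err n)).
  by rewrite -expr2 vv mulrDr; lra.
rewrite ler_pM2l//; lra.
Qed.

Lemma integrable_rnorm_regularized :
  mu.-integrable setT (EFin \o (fun x => rnorm (g x))).
Proof.
rewrite (_ : EFin \o _ = (EFin \o (fun x => rnorm (g x))) \_ D).
  exact/(integrable_mkcond _ mD).
apply/funext => x; rewrite patchE; case: ifPn => // xD /=.
rewrite g0 ?rnorm0// => Dx; move/negP: xD; apply; exact/mem_set.
Qed.

End regularized.

(** The Bochner integral enters the rest of the proof only through its pairings with vectors, which
    are scalar integrals of a representative [g]. Its norm is recovered by pairing it with
    itself. *)
Lemma bochner_integral_re_dot (cmu : measure_is_complete mu) (f : T -> H) :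
  bochner_integrable mu D f ->
  exists g : T -> H, [/\ strong_meas g, forall x, ~ D x -> g x = 0,
    {ae mu, forall x, D x -> f x = g x},
    mu.-integrable setT (EFin \o (fun x => rnorm (g x))) &
    forall v, (\int[mu]_x (q(v, g x))%:E =
               (q(v, bochner_integral mu D f))%:E)%E].
Proof.
move=> [s fs]; have [g [mg g0 fg]] := bochner_regularize fs.
exists g; split; [exact: mg|exact: g0|exact: fg| |].
  exact (integrable_rnorm_regularized cmu fs mg g0 fg).
(* A value for [get] exists because [H] is complete. The sequence [s'] behind the selected value may
   differ from [s], but its pairings have the same limits, which depend on [g] only. *)
have [s' fs' s'I] : [set v | exists2 s, bochner_approx mu D f s &
    bochner_sintegral mu D (s n) @[n --> \oo] --> v] (bochner_integral mu D f).
  apply: getPex; exists (limn (fun n => bochner_sintegral mu D (s n))).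
  exists s => //; exact (is_cvg_bochner_sintegral cmu fs mg fg).
move=> v.
have mg' : mu.-integrable D (EFin \o (fun x => q(v, g x))).
  exact (integrable_re_dot_regularized cmu fs mg fg v).
have -> : (\int[mu]_x (q(v, g x))%:E = \int[mu]_(x in D) (q(v, g x))%:E)%E.
  rewrite [RHS]integral_mkcond; apply: eq_integral => x _; rewrite patchE.
  case: ifPn => // xD; rewrite g0 ?re_dot0r// => Dx.
  by move/negP: xD; apply; exact/mem_set.
rewrite -[LHS]fineK ?integrable_fin_num//; congr EFin.
have cv := @bochner_sintegral_cvg_re_dot cmu f g s' fs' mg fg v.
apply: (cvg_unique _ cv) => //.
by apply: re_dot_cvg => //; exact: cvg_cst.
Qed.

End bochner.

(** * Integration over the triangle *)

Lemma measurable_fun_EFin d (T : measurableType d) (R : realType) (f : T -> R) :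
  measurable_fun setT f -> measurable_fun setT (fun x => (f x)%:E).
Proof. by move=> mf; exact/measurable_EFinP. Qed.

(* The hypothesis [mu_tau] says that [tau] pushes [mu] forward to the Lebesgue
   measure of [[a, b]]; the theorem is the case where [tau] is the identity. *)
Section triangle.
Context {d : measure_display} {T : measurableType d} {R : realType}.
Variables (mu : {sigma_finite_measure set T -> \bar R}) (a b : R)
  (tau : T -> R).
Hypotheses (mtau : measurable_fun setT tau)
  (mu_tau : forall x y, a <= x -> x <= y -> y <= b ->
    mu (tau @^-1` `[x, y]) = (y - x)%:E).

Local Notation D := (tau @^-1` `[a, b]).
Definition triangle : set (T * T) := [set p | Delta a b (tau p.1, tau p.2)].
Local Notation W := triangle.
Local Notation mu2 := (mu \x mu)%E.

Let mtau1 : measurable_fun setT (fun p : T * T => tau p.1).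
Proof. exact: measurableT_comp. Qed.

Let mtau2 : measurable_fun setT (fun p : T * T => tau p.2).
Proof. exact: measurableT_comp. Qed.

Lemma measurable_triangle : measurable W.
Proof.
have -> : W = [set p | a <= tau p.1] `&` [set p | tau p.1 <= tau p.2] `&`
    [set p | tau p.2 <= b].
  by apply/seteqP; split=> p; [move=> [? []]|move=> [[? ?] ?]].
apply: measurableI; first apply: measurableI.
- by rewrite -[X in measurable X]setTI; apply: measurable_fun_le.
- by rewrite -[X in measurable X]setTI; apply: measurable_fun_le.
- by rewrite -[X in measurable X]setTI; apply: measurable_fun_le.
Qed.

Let mW : measurable_fun setT (\1_W : T * T -> R).
Proof. by apply: measurable_indic; exact: measurable_triangle. Qed.

Let mtau_itv x y : measurable (tau @^-1` `[x, y]).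
Proof. by rewrite -[X in measurable X]setTI; exact: mtau. Qed.

Let indic_itv x (p : T) : W (x, p) <-> (D x /\ (tau @^-1` `[tau x, b]) p).
Proof.
rewrite /W /Delta /= !in_itv /=; split.
  by move=> [ax [xp pb]]; rewrite ax xp pb (le_trans xp pb).
by move=> [/andP[-> _] /andP[-> ->]].
Qed.

Let indic_itv2 x (p : T) : W (p, x) <-> (D x /\ (tau @^-1` `[a, tau x]) p).
Proof.
rewrite /W /Delta /= !in_itv /=; split.
  by move=> [ap [px xb]]; rewrite ap px xb (le_trans ap px).
by move=> [/andP[_ ->] /andP[-> ->]].
Qed.

Section weighted.
Variable h : T -> R.
Hypotheses (mh : measurable_fun setT h) (h0 : forall x, 0 <= h x)
  (hD : forall x, ~ D x -> h x = 0).

(** Tonelli: for [x] in [D] the section of the triangle is the preimage of the interval from [tau x]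
    to [b], of mass [b - tau x] by [mu_tau]; elsewhere [h] vanishes. *)
Lemma integral_triangle1 : (\int[mu2]_p (\1_W p * h p.1)%:E =
  \int[mu]_x ((b - tau x) * h x)%:E)%E.
Proof.
have mWh : measurable_fun setT (fun p : T * T => \1_W p * h p.1).
  by apply: measurable_funM => //; exact: measurableT_comp.
rewrite fubini_tonelli1; last 2 first.
- exact: (measurable_fun_EFin mWh).
- by move=> p; rewrite lee_fin mulr_ge0.
apply: eq_integral => x _; rewrite /fubini_F/=.
have [Dx|Dx] := pselect (D x); last first.
  by rewrite hD// mulr0 integral0_eq// => y _; rewrite mulr0.
have mI : measurable_fun setT (\1_(tau @^-1` `[tau x, b]) : T -> R).
  exact: measurable_indic.
rewrite (eq_integral (fun y => (h x)%:E * (\1_(tau @^-1` `[tau x, b]) y)%:E)%E).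
  rewrite ge0_integralZl//; last 2 first.
  - exact: (measurable_fun_EFin mI).
  - by rewrite lee_fin.
  rewrite integral_indic// setIT.
  move: Dx; rewrite /= in_itv /= => /andP[ax xb].
  by rewrite mu_tau// muleC.
move=> y _; rewrite -EFinM mulrC; congr (_ * _)%:E.
rewrite !indicE; congr (nat_of_bool _)%:R; apply/idP/idP => /set_mem yW;
  apply/mem_set.
  by have /indic_itv[] := yW.
exact/indic_itv.
Qed.

(** Here the second coordinate is fixed, and the section is the preimage of the interval from [a] to
    [tau x]. *)
Lemma integral_triangle2 : (\int[mu2]_p (\1_W p * h p.2)%:E =
  \int[mu]_x ((tau x - a) * h x)%:E)%E.
Proof.
have mWh : measurable_fun setT (fun p : T * T => \1_W p * h p.2).
  by apply: measurable_funM => //; exact: measurableT_comp.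
rewrite fubini_tonelli2; last 2 first.
- exact: (measurable_fun_EFin mWh).
- by move=> p; rewrite lee_fin mulr_ge0.
apply: eq_integral => x _; rewrite /fubini_G/=.
have [Dx|Dx] := pselect (D x); last first.
  by rewrite hD// mulr0 integral0_eq// => y _; rewrite mulr0.
have mI : measurable_fun setT (\1_(tau @^-1` `[a, tau x]) : T -> R).
  exact: measurable_indic.
rewrite (eq_integral (fun y => (h x)%:E * (\1_(tau @^-1` `[a, tau x]) y)%:E)%E).
  rewrite ge0_integralZl//; last 2 first.
  - exact: (measurable_fun_EFin mI).
  - by rewrite lee_fin.
  rewrite integral_indic// setIT.
  move: Dx; rewrite /= in_itv /= => /andP[ax xb].
  by rewrite mu_tau// muleC.
move=> y _; rewrite -EFinM mulrC; congr (_ * _)%:E.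
rewrite !indicE; congr (nat_of_bool _)%:R; apply/idP/idP => /set_mem yW;
  apply/mem_set.
  by have /indic_itv2[] := yW.
exact/indic_itv2.
Qed.

End weighted.

Section symmetric.
Variable g : T * T -> R.
Hypotheses (ig : mu2.-integrable setT (EFin \o g))
  (gC : forall x y, g (x, y) = g (y, x))
  (gD : forall p, ~ (D p.1 /\ D p.2) -> g p = 0).

Let mg : measurable_fun setT g.
Proof. by apply/(@measurable_EFinP _ _ _ setT g); exact: measurable_int ig. Qed.

Let sw (p : T * T) := (p.2, p.1).

(** Each section of the diagonal lies in the preimage of the degenerate interval at [tau x], which
    [mu_tau] makes null as long as [x] is in [D]. *)
Let ae_off_diagonal : {ae mu2, forall p, D p.1 -> tau p.1 <> tau p.2}.
Proof.
pose Z := [set p : T * T | D p.1] `&` [set p | tau p.1 = tau p.2].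
have mZ : measurable Z.
  apply: measurableI.
    rewrite (_ : mkset _ = fst @^-1` D)// -[X in measurable X]setTI.
    by apply: measurable_fst => //; exact: mtau_itv.
  have -> : [set p : T * T | tau p.1 = tau p.2] =
      [set p | tau p.1 <= tau p.2] `&` [set p | tau p.2 <= tau p.1].
    apply/seteqP; split=> [p /= ->|p /= [? ?]]; first by split.
    by apply/eqP; rewrite eq_le; apply/andP.
  by apply: measurableI; rewrite -[X in measurable X]setTI;
    apply: measurable_fun_le.
exists Z; split => //; last by move=> p /= /not_implyP[? /contrapT].
rewrite /product_measure1/= integral0_eq// => x _ /=.
have [Dx|Dx] := pselect (D x); last first.
  rewrite (_ : xsection _ _ = set0) ?measure0//; apply/seteqP; split=> // y.
  by rewrite /xsection /= => /set_mem [].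
apply: (@subset_measure0 _ _ _ _ _ (tau @^-1` `[tau x, tau x])) => //.
- exact: measurable_xsection.
- move=> y; rewrite /xsection /= => /set_mem [_ /= <-].
  by rewrite in_itv/= lexx.
- by move: Dx; rewrite /= in_itv /= => /andP[ax xb]; rewrite mu_tau// subrr.
Qed.

Let igW : mu2.-integrable setT (fun p => (\1_W p * g p)%:E).
Proof.
have mWg : measurable_fun setT (fun p : T * T => \1_W p * g p).
  exact: measurable_funM.
apply: le_integrable ig => //; first exact: (measurable_fun_EFin mWg).
move=> p _; rewrite /= lee_fin normrM ger0_norm// ler_piMl//.
Qed.

Let mWsw : measurable_fun setT (fun p => \1_W (sw p) : R).
Proof. by apply: measurableT_comp => //; exact: measurable_swap. Qed.

Let igWsw : mu2.-integrable setT (fun p => (\1_W (sw p) * g p)%:E).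
Proof.
have mWg : measurable_fun setT (fun p : T * T => \1_W (sw p) * g p).
  exact: measurable_funM.
apply: le_integrable ig => //; first exact: (measurable_fun_EFin mWg).
move=> p _; rewrite /= lee_fin normrM ger0_norm// ler_piMl//.
Qed.

(* The triangle and its mirror image cover the square, and they overlap in the
   null set of pairs with [tau p.1 = tau p.2]. *)
Lemma integral_triangle_sym :
  (\int[mu2]_p (g p)%:E = 2%:E * \int[mu2]_p (\1_W p * g p)%:E)%E.
Proof.
have -> : (2%:E * \int[mu2]_p (\1_W p * g p)%:E =
    \int[mu2]_p (\1_W p * g p)%:E + \int[mu2]_p (\1_W (sw p) * g p)%:E)%E.
  rewrite (_ : 2%:E = 1 + 1)%E// ge0_muleDl// mul1e; congr (_ + _)%E.
  (* Integrating the two halves in opposite orders makes their integrands match by the symmetry of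
     [g]. *)
  rewrite -(integral21_prod_meas1 igW) -(integral12_prod_meas1 igWsw).
  apply: eq_integral => x _; apply: eq_integral => y _ /=.
  by rewrite /fubini_F /sw /= gC.
rewrite -integralD//; apply: ae_eq_integral => //.
- exact: measurable_int ig.
- exact: measurable_int (integrableD _ igW igWsw).
apply: filterS ae_off_diagonal => p Np _; rewrite -EFinD -mulrDl.
have [[D1 D2]|D12] := pselect (D p.1 /\ D p.2); last by rewrite gD// mulr0.
(* Off the diagonal exactly one of [p] and [sw p] lies in the triangle. *)
have : \1_W p + \1_W (sw p) = 1 :> R; last by move=> ->; rewrite mul1r.
move: D1 D2 (Np D1); rewrite /= !in_itv /= => /andP[a1 b1] /andP[a2 b2] /eqP.
rewrite neq_lt => /orP[] lt12.
  rewrite [X in X + _]indicE mem_set; last by split => //=; rewrite ltW.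
  by rewrite indicE memNset ?addr0// => -[_ [+ _]]/=; rewrite leNgt lt12.
rewrite [X in _ + X]indicE mem_set; last by split => //=; rewrite ltW.
by rewrite indicE memNset ?add0r// => -[_ [+ _]]/=; rewrite leNgt lt12.
Qed.

End symmetric.
End triangle.

(** * The integral inequality for a symmetric kernel dominated by a product *)

Section triangle_inequality.
Context {d : measure_display} {T : measurableType d} {R : realType}.
Variables (mu : {sigma_finite_measure set T -> \bar R}) (a b : R)
  (tau : T -> R).
Hypotheses (mtau : measurable_fun setT tau)
  (mu_tau : forall x y, a <= x -> x <= y -> y <= b ->
    mu (tau @^-1` `[x, y]) = (y - x)%:E).
Local Notation D := (tau @^-1` `[a, b]).
Local Notation W := (triangle a b tau).
Local Notation mu2 := (mu \x mu)%E.

(** In the application [N] is the norm of the representative, [g] the real part of the inner product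
    of its values, and [G] the squared norm of its integral. *)
Variables (N : T -> R) (g : T * T -> R) (G : R).
Hypotheses (iN : mu.-integrable setT (EFin \o N)) (N0 : forall x, 0 <= N x)
  (ND : forall x, ~ D x -> N x = 0)
  (mg : measurable_fun setT g) (gC : forall x y, g (x, y) = g (y, x))
  (gN : forall x y, `|g (x, y)| <= N x * N y)
  (gG : (\int[mu]_x \int[mu]_y (g (x, y))%:E = G%:E)%E).

Let mN : measurable_fun setT N.
Proof. by apply/(@measurable_EFinP _ _ _ setT N); exact: measurable_int iN. Qed.

(** [P] is the integrable majorant. [A], [B] and [E] are the ingredients of [rho] cut off to the
    triangle; the squares in [A] and [B] are not integrable a priori. *)
Let P (p : T * T) := N p.1 * N p.2.
Let A (p : T * T) := \1_W p * N p.1 ^+ 2.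
Let B (p : T * T) := \1_W p * N p.2 ^+ 2.
Let E (p : T * T) := \1_W p * g p.

Let mW : measurable_fun setT (\1_W : T * T -> R).
Proof. by apply: measurable_indic; exact: measurable_triangle. Qed.

Let mN2 : measurable_fun setT (fun x => N x ^+ 2).
Proof. exact: measurable_funX. Qed.

Let mP : measurable_fun setT P.
Proof. by apply: measurable_funM; exact: measurableT_comp. Qed.

Let mA : measurable_fun setT A.
Proof. by apply: measurable_funM => //; exact: (measurableT_comp mN2). Qed.

Let mB : measurable_fun setT B.
Proof. by apply: measurable_funM => //; exact: (measurableT_comp mN2). Qed.

Let mE : measurable_fun setT E.
Proof. exact: measurable_funM. Qed.

Let P0 p : 0 <= P p. Proof. by rewrite mulr_ge0. Qed.

Let A0 p : 0 <= A p. Proof. by rewrite mulr_ge0// sqr_ge0. Qed.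

Let B0 p : 0 <= B p. Proof. by rewrite mulr_ge0// sqr_ge0. Qed.

Let ge0_integrable (d' : measure_display) (T' : measurableType d')
    (m : {measure set T' -> \bar R}) (f : T' -> R) :
  measurable_fun setT f -> (forall x, 0 <= f x) ->
  (\int[m]_x (f x)%:E < +oo)%E -> m.-integrable setT (EFin \o f).
Proof.
move=> mf f0 fi; apply/integrableP; split; first exact/measurable_EFinP.
rewrite (eq_integral (fun x => (f x)%:E))// => x _ /=.
by rewrite ger0_norm.
Qed.

Let iP : mu2.-integrable setT (EFin \o P).
Proof.
apply: ge0_integrable => //.
rewrite (fubini_tonelli1 (fun p => (P p)%:E)); last 2 first.
- exact: measurable_fun_EFin mP.
- by move=> p; rewrite lee_fin.
have iNfin := integrable_fin_num measurableT iN.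
rewrite /fubini_F (eq_integral (fun x => (N x)%:E * \int[mu]_y (N y)%:E)%E).
  rewrite ge0_integralZr//; last 3 first.
  - exact: measurable_fun_EFin mN.
  - by move=> x _; rewrite lee_fin.
  - by apply: integral_ge0 => x _; rewrite lee_fin.
  by rewrite ltey_eq fin_numM.
move=> x _; rewrite -ge0_integralZl//.
- exact: measurable_fun_EFin mN.
- by move=> y _; rewrite lee_fin.
- by rewrite lee_fin.
Qed.

Let gP p : `|g p| <= P p.
Proof. by case: p => x y; exact: gN. Qed.

Let ig : mu2.-integrable setT (EFin \o g).
Proof.
apply: le_integrable iP => //; first exact: (measurable_fun_EFin mg).
by move=> p _; rewrite /= lee_fin [leRHS]ger0_norm.
Qed.

Let iE : mu2.-integrable setT (EFin \o E).
Proof.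
apply: le_integrable ig => //; first exact: (measurable_fun_EFin mE).
by move=> p _; rewrite /= lee_fin normrM ger0_norm// ler_piMl.
Qed.

Let intE : (\int[mu2]_p (E p)%:E = (G / 2)%:E)%E.
Proof.
have := @integral_triangle_sym _ _ _ mu a b tau mtau mu_tau g ig gC _.
rewrite -(integral12_prod_meas1 ig) gG -/E => eqG.
have iEfin : (\int[mu2]_p (E p)%:E)%E \is a fin_num.
  exact: integrable_fin_num iE.
have /eqG : forall p, ~ (D p.1 /\ D p.2) -> g p = 0.
  move=> p Dp; apply/eqP; rewrite -normr_le0; apply: le_trans (gP p) _.
  have [D1|D1] := pselect (D p.1); last by rewrite /P ND ?mul0r.
  by rewrite /P (@ND p.2) ?mulr0// => D2; apply: Dp.
rewrite -(fineK iEfin) -EFinM => -[->]; congr EFin; lra.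
Qed.

(** The two weights are nonnegative on [D]; outside they may be negative, but there [N] vanishes. *)
Let alpha x := (b - tau x) * N x ^+ 2.
Let beta x := (tau x - a) * N x ^+ 2.

Let alpha0 x : 0 <= alpha x.
Proof.
have [|Dx] := pselect (D x); last by rewrite /alpha ND// expr0n mulr0.
rewrite /= in_itv /= => /andP[ax xb].
by rewrite mulr_ge0 ?sqr_ge0// subr_ge0.
Qed.

Let beta0 x : 0 <= beta x.
Proof.
have [|Dx] := pselect (D x); last by rewrite /beta ND// expr0n mulr0.
rewrite /= in_itv /= => /andP[ax xb].
by rewrite mulr_ge0 ?sqr_ge0// subr_ge0.
Qed.

Let malpha : measurable_fun setT alpha.
Proof. by apply: measurable_funM => //; exact: measurable_funB. Qed.

Let mbeta : measurable_fun setT beta.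
Proof. by apply: measurable_funM => //; exact: measurable_funB. Qed.

Let intA : (\int[mu2]_p (A p)%:E = \int[mu]_x (alpha x)%:E)%E.
Proof.
apply: (@integral_triangle1 _ _ _ mu a b tau mtau mu_tau
  (fun x => N x ^+ 2)) => //.
- by move=> x; rewrite sqr_ge0.
- by move=> x Dx; rewrite ND// expr0n.
Qed.

Let intB : (\int[mu2]_p (B p)%:E = \int[mu]_x (beta x)%:E)%E.
Proof.
apply: (@integral_triangle2 _ _ _ mu a b tau mtau mu_tau
  (fun x => N x ^+ 2)) => //.
- by move=> x; rewrite sqr_ge0.
- by move=> x Dx; rewrite ND// expr0n.
Qed.

(** [sigma] and [pi_] stand for [Gamma + gamma] and [gamma * Gamma], so that [rho] is the expanded
    real part from the hypothesis. *)
Variables (sigma pi_ K : R).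
Local Notation rho p := (sigma * g p - pi_ * N p.2 ^+ 2 - N p.1 ^+ 2).
Hypotheses (K0 : 0 <= K)
  (rho0 : {ae mu2, forall p, W p -> 0 <= rho p})
  (NK : {ae mu2, forall p, W p -> N p.1 <= K * N p.2}).

Let ae_le_fin (f h : T * T -> R) :
  measurable_fun setT f -> (forall p, 0 <= f p) ->
  mu2.-integrable setT (EFin \o h) -> (forall p, 0 <= h p) ->
  {ae mu2, forall p, f p <= h p} -> (\int[mu2]_p (f p)%:E < +oo)%E.
Proof.
move=> mf f0 ih h0 fh.
apply: (@le_lt_trans _ _ (\int[mu2]_p (h p)%:E)%E); last first.
  by rewrite ltey_eq (integrable_fin_num _ ih).
apply: ae_ge0_le_integral => //.
- by move=> p _; rewrite lee_fin.
- exact: measurable_fun_EFin mf.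
- by move=> p _; rewrite lee_fin.
- exact: measurable_int ih.
- by apply: filterS fh => p fhp _; rewrite lee_fin.
Qed.

Let iA : mu2.-integrable setT (EFin \o A).
Proof.
apply: ge0_integrable => //.
(* On the triangle one factor [N p.1] of the square is traded for [K * N p.2]. *)
apply: (@ae_le_fin _ (fun p => K * P p)) => //.
- exact: (integrableZl measurableT K iP).
- by move=> p; rewrite mulr_ge0.
- apply: filterS NK => p NKp; rewrite /A indicE.
  have [/set_mem Wp|_] := boolP (p \in W); last by rewrite mul0r mulr_ge0.
  rewrite mul1r /P expr2 mulrA [K * _]mulrC -mulrA.
  by rewrite ler_wpM2l// NKp.
Qed.

(** The assumed bound has two sources: [rho >= 0] if [pi_] is positive, and [rho = 0] if [pi_] is
    negative. *)
Let iB : pi_ != 0 ->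
  {ae mu2, forall p, W p ->
    `|pi_| * N p.2 ^+ 2 <= N p.1 ^+ 2 + `|sigma| * P p} ->
  mu2.-integrable setT (EFin \o B).
Proof.
move=> pi0 le_B; have pi_gt0 : 0 < `|pi_| by rewrite normr_gt0.
apply: ge0_integrable => //.
apply: (@ae_le_fin _ (fun p => `|pi_|^-1 * (A p + `|sigma| * P p))) => //.
- have iAP := integrableD measurableT iA (integrableZl measurableT `|sigma| iP).
  exact: (integrableZl measurableT (`|pi_|^-1) iAP).
- by move=> p; rewrite mulr_ge0 ?invr_ge0// addr_ge0// mulr_ge0.
- apply: filterS le_B => p Bp; rewrite ler_pdivlMl//.
  rewrite /A /B indicE.
  have [/set_mem Wp|_] := boolP (p \in W).
    by rewrite !mul1r Bp.
  by rewrite !mul0r mulr0 add0r mulr_ge0.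
Qed.

Let sigma_g p : sigma * g p <= `|sigma| * P p.
Proof.
apply: le_trans (ler_norm _) _; rewrite normrM.
by rewrite ler_wpM2l.
Qed.

Let sigma_gN p : - (sigma * g p) <= `|sigma| * P p.
Proof.
apply: le_trans (ler_norm _) _; rewrite normrN normrM.
by rewrite ler_wpM2l.
Qed.

Let integrand x := (b - tau x + pi_ * (tau x - a)) * N x ^+ 2.
Let integrandE x : integrand x = alpha x + pi_ * beta x.
Proof. by rewrite /integrand /alpha /beta; ring. Qed.

Let ialpha : mu.-integrable setT (EFin \o alpha).
Proof.
apply: ge0_integrable => //.
by rewrite -intA ltey_eq (integrable_fin_num _ iA).
Qed.

Let conclusion : Prop :=
  [/\ ((\int[mu]_x ((EFin \o integrand)^\+ x)) +?
          - (\int[mu]_x ((EFin \o integrand)^\- x)))%E,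
      (\int[mu]_x (integrand x)%:E <= (sigma / 2 * G)%:E)%E &
      (\int[mu]_x (integrand x)%:E = (sigma / 2 * G)%:E)%E <->
      {ae mu2, forall p, W p -> rho p = 0}].

(** Integrability is asked after multiplication by [pi_], which includes [pi_ = 0] with [B] of
    infinite integral. The right side of the inequality minus the left is then the integral of [rho]
    over the triangle. *)
Let conclusion_finite : mu2.-integrable setT (fun p => (pi_ * B p)%:E) ->
  mu.-integrable setT (fun x => (pi_ * beta x)%:E) ->
  (\int[mu2]_p (pi_ * B p)%:E = \int[mu]_x (pi_ * beta x)%:E)%E ->
  conclusion.
Proof.
move=> ipB ipbeta eB.
have iint : mu.-integrable setT (EFin \o integrand).
  rewrite (_ : _ \o _ = (EFin \o alpha) \+ (fun x => (pi_ * beta x)%:E))%E.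
    exact: integrableD.
  by apply/funext => x /=; rewrite integrandE.
pose r p := \1_W p * rho p.
have rE p : (r p)%:E = ((sigma%:E * (E p)%:E - (pi_ * B p)%:E) - (A p)%:E)%E.
  by rewrite /r /E /A /B -EFinM -!EFinB; congr EFin; ring.
have isE := integrableZl measurableT sigma iE.
have i1 := integrableB measurableT isE ipB.
have i2 := integrableB measurableT i1 iA.
have ir : mu2.-integrable setT (EFin \o r).
  by apply: eq_integrable i2 => // p _ /=; rewrite rE.
have intr : (\int[mu2]_p (r p)%:E =
    (sigma / 2 * G)%:E - \int[mu]_x (integrand x)%:E)%E.
  transitivity
    (\int[mu2]_p (sigma%:E * (E p)%:E - (pi_ * B p)%:E - (A p)%:E))%E.
    by apply: eq_integral => p _; rewrite rE.
  rewrite integralB// integralB// integralZl// intE eB intA.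
  have -> : (\int[mu]_x (integrand x)%:E =
      \int[mu]_x ((alpha x)%:E + (pi_ * beta x)%:E))%E.
    by apply: eq_integral => x _; rewrite integrandE.
  rewrite integralD//.
  have := integrable_fin_num measurableT ialpha.
  have := integrable_fin_num measurableT ipbeta.
  move=> /fineK <- /fineK <-.
  by rewrite -EFinM -EFinD -!EFinB; congr EFin; lra.
have r_ge0 : {ae mu2, forall p, 0 <= r p}.
  apply: filterS rho0 => p rp; rewrite /r indicE.
  have [/set_mem Wp|_] := boolP (p \in W); last by rewrite mul0r.
  by rewrite mul1r rp.
(* The integral of an almost everywhere nonnegative [r] is its L1 norm, which gives both the
   inequality and the case of equality. *)
have intabs : (\int[mu2]_p (r p)%:E = \int[mu2]_p `|(r p)%:E|)%E.
  apply: ae_eq_integral => //.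
  - exact: measurable_int ir.
  - exact: measurable_int (integrable_abse ir).
  - by apply: filterS r_ge0 => p rp _; rewrite /= ger0_norm.
have ifin := integrable_fin_num measurableT iint.
split.
- by rewrite fin_num_adde_defr// integrable_pos_fin_num.
- rewrite -sube_ge0; last by rewrite ifin.
  by rewrite -intr intabs integral_ge0.
- have mr : measurable_fun setT (EFin \o r) by exact: measurable_int ir.
  have -> : (\int[mu]_x (integrand x)%:E = (sigma / 2 * G)%:E)%E <->
     (\int[mu2]_p `|(EFin \o r) p| = 0)%E.
    rewrite -intabs intr -(fineK ifin) -EFinB; split=> [[->]|[/eqP]].
      by rewrite subrr.
    by rewrite subr_eq0 => /eqP ->.
  rewrite ae_eq_integral_abs//; split; apply: filterS => p.
    move=> /(_ I) [] rp Wp; move: rp.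
    by rewrite /r indicE mem_set// mul1r.
  move=> rp _; rewrite /r /= indicE.
  by have [/set_mem /rp ->|_] := boolP (p \in W); rewrite ?mulr0 ?mul0r.
Qed.

(** Here the left-hand integral is [-oo], and both sides of the equality criterion are false. *)
Let conclusion_infinite :
  (\int[mu]_x (beta x)%:E = +oo)%E -> pi_ != 0 -> conclusion.
Proof.
move=> beta_oo pi0.
have nB : ~ mu2.-integrable setT (EFin \o B).
  by move=> /(integrable_fin_num measurableT); rewrite intB beta_oo.
(* A positive [pi_] would let [rho >= 0] dominate [B] by integrable terms. *)
have pi_lt0 : pi_ < 0.
  rewrite lt_neqAle pi0/= leNgt; apply/negP => pi_gt0; apply/nB/iB => //.
  apply: filterS rho0 => p rp Wp; rewrite gtr0_norm//.
  have := rp Wp; have := sigma_g p.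
  have := sqr_ge0 (N p.1); lra.
have mi : measurable_fun setT integrand.
  rewrite (_ : integrand = fun x => alpha x + pi_ * beta x).
    by apply: measurable_funD => //; exact: measurable_funM.
  by apply/funext.
have mi' : measurable_fun setT (EFin \o integrand).
  exact: measurable_fun_EFin mi.
have pos_fin : (\int[mu]_x ((EFin \o integrand)^\+ x) < +oo)%E.
  apply: (@le_lt_trans _ _ (\int[mu]_x (alpha x)%:E)%E); last first.
    by rewrite ltey_eq (integrable_fin_num _ ialpha).
  apply: ge0_le_integral => //.
  - exact: measurable_funepos.
  - exact: measurable_fun_EFin malpha.
  - move=> x _; rewrite funeposE /= -EFin_max lee_fin ge_max alpha0 andbT.
    by rewrite integrandE gerDl nmulr_rle0.
have neg_oo : (\int[mu]_x ((EFin \o integrand)^\- x) = +oo)%E.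
  apply: contrapT => /eqP; rewrite -ltey => neg_fin.
  suff: (\int[mu]_x (beta x)%:E < +oo)%E by rewrite beta_oo.
  have npi : 0 < - pi_ by rewrite oppr_gt0.
  (* Solving [integrand = alpha + pi_ * beta] for [beta] gives [(- pi_)^-1 * (alpha - integrand)],
     and [- integrand] is at most the negative part. *)
  apply: (@le_lt_trans _ _ (\int[mu]_x ((- pi_)^-1%:E *
      ((EFin \o integrand)^\- x + (alpha x)%:E)))%E).
    apply: ge0_le_integral => //.
    + by move=> x _; rewrite lee_fin.
    + exact: measurable_fun_EFin mbeta.
    + apply: emeasurable_funM => //; apply: emeasurable_funD.
        exact: measurable_funeneg.
      exact: measurable_fun_EFin malpha.
    + move=> x _; rewrite funenegE /= -EFin_max -EFinD -EFinM lee_fin.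
      rewrite ler_pdivlMl//; have : - integrand x <= Num.max (- integrand x) 0.
        by rewrite le_max lexx.
      rewrite integrandE; lra.
  rewrite ge0_integralZl//; last 3 first.
  - apply: emeasurable_funD.
      exact: measurable_funeneg.
    exact: measurable_fun_EFin malpha.
  - by move=> x _; rewrite adde_ge0// lee_fin.
  - by rewrite lee_fin invr_ge0 ltW.
  rewrite ge0_integralD//; last 3 first.
  - exact: measurable_funeneg.
  - by move=> x _; rewrite lee_fin.
  - exact: measurable_fun_EFin malpha.
  rewrite lte_mul_pinfty// ?lee_fin ?invr_ge0 ?(ltW npi)//.
  by rewrite lte_add_pinfty// ltey_eq (integrable_fin_num _ ialpha).
have fin_pos : (\int[mu]_x ((EFin \o integrand)^\+ x))%E \is a fin_num.
  by rewrite ge0_fin_numE// integral_ge0.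
have intNy : (\int[mu]_x (integrand x)%:E = -oo)%E.
  by rewrite integralE neg_oo -(fineK fin_pos).
split.
- by rewrite neg_oo fin_num_adde_defr.
- by rewrite intNy leNye.
- rewrite intNy; split => // eq0; exfalso; apply/nB/iB => //.
  apply: filterS eq0 => p /[apply]; rewrite ltr0_norm//.
  have := sigma_gN p; lra.
Qed.

Lemma triangle_integral_inequality :
  let integrand x :=
    (((b - tau x) + pi_ * (tau x - a)) * N x ^+ 2)%:E in
  [/\ ((\int[mu]_x (integrand^\+ x)) +?
          - (\int[mu]_x (integrand^\- x)))%E,
      (\int[mu]_x integrand x <= (sigma / 2 * G)%:E)%E &
      (\int[mu]_x integrand x = (sigma / 2 * G)%:E)%E <->
      {ae mu2, forall p, W p -> rho p = 0}].
Proof.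
change conclusion.
(* For [pi_ = 0] the weight [beta] drops out, whatever its integral; otherwise that integral decides
   between the two cases. *)
have [pi0|pi0] := eqVneq pi_ 0.
  apply: conclusion_finite.
  - rewrite (_ : (fun _ => _) = cst 0%E); first exact: integrable0.
    by apply/funext => p; rewrite pi0 mul0r.
  - rewrite (_ : (fun _ => _) = cst 0%E); first exact: integrable0.
    by apply/funext => p; rewrite pi0 mul0r.
  - by rewrite !integral0_eq// => x _; rewrite pi0 mul0r.
have [beta_oo|beta_fin] := eqVneq (\int[mu]_x (beta x)%:E)%E +oo%E.
  exact: conclusion_infinite.
rewrite -ltey in beta_fin.
have ibeta : mu.-integrable setT (EFin \o beta) by exact: ge0_integrable.
have iB' : mu2.-integrable setT (EFin \o B).
  by apply: ge0_integrable => //; rewrite intB.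
apply: conclusion_finite.
- exact: (integrableZl measurableT pi_ iB').
- exact: (integrableZl measurableT pi_ ibeta).
- transitivity (pi_%:E * \int[mu2]_p (B p)%:E)%E.
    by rewrite -(integralZl measurableT iB').
  by rewrite intB -(integralZl measurableT ibeta).
Qed.

End triangle_inequality.

(** * The inequality *)

Section pointwise.
Context {R : realType} {k : scalar_kind} {H : normedModType (scalar R k)}.
Variables (ip : {dot H for @scalar_conj R k}).
Hypothesis ip_norm : forall x : H, ip x x = `|x| ^+ 2.
Variables (gamma Gamma : R) (x y : H).

Lemma scalar_re_ip_expand :
  scalar_re (ip (of_real k Gamma *: y - x) (x - of_real k gamma *: y)) =
  (Gamma + gamma) * re_dot ip y x - gamma * Gamma * rnorm y ^+ 2 - rnorm x ^+ 2.
Proof.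
rewrite -/(re_dot ip _ _) re_dotDl !re_dotDr !re_dotNl !re_dotNr.
rewrite !(re_dotZl, re_dotZr) !re_dotxx// (re_dotC ip x y); ring.
Qed.

(** The multiples of [y] by [gamma] and [Gamma] are the ends of a diameter of the ball about their
    midpoint, and the real part is minus the power of [x] with respect to its sphere. *)
Lemma sqr_rnorm_center :
  (2^-1 * `|Gamma - gamma| * rnorm y) ^+ 2 -
    rnorm (x - of_real k ((Gamma + gamma) / 2) *: y) ^+ 2 =
  scalar_re (ip (of_real k Gamma *: y - x) (x - of_real k gamma *: y)).
Proof.
rewrite scalar_re_ip_expand -(re_dotxx ip_norm (x - _)) re_dotDl !re_dotDr.
rewrite !re_dotNl !re_dotNr !(re_dotZl, re_dotZr) !re_dotxx// (re_dotC ip x y).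
by rewrite !exprMn real_normK ?num_real//; field.
Qed.

Let radius_ge0 : 0 <= 2^-1 * `|Gamma - gamma| * rnorm y.
Proof. by rewrite !mulr_ge0// rnorm_ge0. Qed.

Lemma re_ge0_center :
  0 <= scalar_re (ip (of_real k Gamma *: y - x) (x - of_real k gamma *: y)) <->
  rnorm (x - of_real k ((Gamma + gamma) / 2) *: y) <=
    2^-1 * `|Gamma - gamma| * rnorm y.
Proof.
by rewrite -sqr_rnorm_center subr_ge0 ler_pXn2r// nnegrE ?rnorm_ge0.
Qed.

Lemma re_eq0_center :
  scalar_re (ip (of_real k Gamma *: y - x) (x - of_real k gamma *: y)) = 0 <->
  rnorm (x - of_real k ((Gamma + gamma) / 2) *: y) =
    2^-1 * `|Gamma - gamma| * rnorm y.
Proof.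
rewrite -sqr_rnorm_center; split=> [/eqP|->]; last by rewrite subrr.
rewrite subr_eq0 => /eqP/esym e; apply/eqP.
by rewrite -(eqrXn2 (ltn0Sn 1)) ?rnorm_ge0// e.
Qed.

(** A point of a ball has norm at most that of the centre plus the radius; this supplies the
    constant [K] of the domination. *)
Lemma rnorm_le_of_center :
  rnorm (x - of_real k ((Gamma + gamma) / 2) *: y) <=
    2^-1 * `|Gamma - gamma| * rnorm y ->
  rnorm x <= (`|(Gamma + gamma) / 2| + 2^-1 * `|Gamma - gamma|) * rnorm y.
Proof.
move=> xy; rewrite mulrDl addrC.
rewrite -{1}(subrK (of_real k ((Gamma + gamma) / 2) *: y) x).
by apply: le_trans (ler_rnormD _ _) _; rewrite rnormZ lerD2r.
Qed.

End pointwise.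

(** The exceptional pairs lie in two strips, each the product of a null set with the whole space. *)
Lemma ae_fst_snd (d : measure_display) (T : measurableType d) (R : realType)
    (mu : {sigma_finite_measure set T -> \bar R}) (Q : T -> Prop) :
  {ae mu, forall x, Q x} -> {ae (mu \x mu)%E, forall p, Q p.1 /\ Q p.2}.
Proof.
move=> [N [mN N0 QN]].
have mu2N1 : (mu \x mu)%E (N `*` setT) = 0%E.
  by rewrite product_measure1E// [X in (X * _)%E]N0 mul0e.
have mu2N2 : (mu \x mu)%E (setT `*` N) = 0%E.
  by rewrite product_measure1E// [X in (_ * X)%E]N0 mule0.
have n1 : (mu \x mu)%E.-negligible (N `*` setT).
  by apply/negligibleP => //; exact: measurableX.
have n2 : (mu \x mu)%E.-negligible (setT `*` N).
  by apply/negligibleP => //; exact: measurableX.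
apply: negligibleS (negligibleU n1 n2) => p /= /not_andP[nQ|nQ].
  by left; split => //; exact: QN.
by right; split => //; exact: QN.
Qed.

(** Completeness transfers measurability from [v] to [u] on [D], and the vanishing of [v] outside
    [D] extends the domain to the whole space. *)
Lemma complete_integral_restrict (d : measure_display) (T : measurableType d)
    (R : realType) (mu : {measure set T -> \bar R}) (D : set T)
    (u v : T -> \bar R) :
  measure_is_complete mu -> measurable D -> measurable_fun setT v ->
  (forall x, ~ D x -> v x = 0%E) -> {ae mu, forall x, D x -> u x = v x} ->
  (\int[mu]_(x in D) u x = \int[mu]_x v x)%E.
Proof.
move=> cmu mD mv vD uv.
have mvD : measurable_fun D v by apply: measurable_funS mv.
transitivity (\int[mu]_(x in D) v x)%E.
  apply: ae_eq_integral => //; apply: (ae_measurable_fun cmu _ mvD).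
  exact: ae_eq_sym.
rewrite integral_mkcond; apply: eq_integral => x _; rewrite patchE.
case: ifPn => // xD; rewrite vD// => Dx; move/negP: xD; apply; exact/mem_set.
Qed.

(** Borel sets are Lebesgue measurable. As [tau], the identity keeps apart the two sigma-algebras on
    the line: the Lebesgue one on its source, the Borel one on its target. *)
Lemma leb_measurable_id (R : realType) :
  measurable_fun [set: caratheodory_type ((@wlength R idfun)^*)%mu] (@idfun R).
Proof. by move=> _ B mB; rewrite setTI; exact: sub_caratheodory. Qed.

Lemma leb_itvcc (R : realType) (x y : R) :
  x <= y -> @leb R `[x, y] = (y - x)%:E.
Proof.
move=> xy; transitivity (@lebesgue_measure R `[x, y]); first by [].
rewrite lebesgue_measure_itv/= lte_fin; case: ltP => // yx.
by rewrite (@le_anti _ _ x y) ?subrr// xy yx.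
Qed.

(** * From a Bochner integrable function to its measurable representative *)

Section pushforward.
Context {d : measure_display} {T : measurableType d} {R : realType}
  {k : scalar_kind} {H : completeNormedModType (scalar R k)}.
Variables (ip : {dot H for @scalar_conj R k}).
Hypothesis ip_norm : forall x : H, ip x x = `|x| ^+ 2.
Variables (mu : {sigma_finite_measure set T -> \bar R}) (a b : R)
  (tau : T -> R).
Hypotheses (cmu : measure_is_complete mu) (le_ab : a <= b)
  (mtau : measurable_fun setT tau)
  (mu_tau : forall x y, a <= x -> x <= y -> y <= b ->
    mu (tau @^-1` `[x, y]) = (y - x)%:E).
Local Notation D := (tau @^-1` `[a, b]).
Local Notation mu2 := (mu \x mu)%E.
Variables (f : T -> H) (gamma Gamma : R).
Hypothesis f_int : bochner_integrable mu D f.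

Let re1 t s := scalar_re (ip (of_real k Gamma *: f s - f t)
                             (f t - of_real k gamma *: f s)).
Let integrand s :=
  (((b - tau s) + gamma * Gamma * (tau s - a)) * rnorm (f s) ^+ 2)%:E.

Let re1_integral_inequality :
  {ae mu2, forall p, triangle a b tau p -> 0 <= re1 p.1 p.2} ->
  [/\ ((\int[mu]_(s in D) (integrand^\+ s)) +?
          - (\int[mu]_(s in D) (integrand^\- s)))%E,
      (\int[mu]_(s in D) integrand s <=
        ((Gamma + gamma) / 2 * rnorm (bochner_integral mu D f) ^+ 2)%:E)%E &
      (\int[mu]_(s in D) integrand s =
        ((Gamma + gamma) / 2 * rnorm (bochner_integral mu D f) ^+ 2)%:E)%E <->
      {ae mu2, forall p, triangle a b tau p -> re1 p.1 p.2 = 0}].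
Proof.
move=> re1_ge0.
have mD : measurable D.
  by rewrite -[X in measurable X]setTI; exact: mtau.
have D_fin : (mu D < +oo)%E by rewrite mu_tau// ltry.
have [g [mg g0 fg ig intg]] :=
  bochner_integral_re_dot ip_norm mD D_fin cmu f_int.
set I := bochner_integral mu D f in intg *.
pose N x := rnorm (g x).
pose q (p : T * T) := re_dot ip (g p.2) (g p.1).
have ND x : ~ D x -> N x = 0 by move=> Dx; rewrite /N g0// rnorm0.
have mq : measurable_fun setT q.
  by apply: strong_meas_re_dot => //; apply: strong_meas_comp.
have fg2 : {ae mu2, forall p, triangle a b tau p ->
    f p.1 = g p.1 /\ f p.2 = g p.2}.
  apply: filterS (ae_fst_snd fg) => p [f1 f2] [ap [pp pb]]; split.
    by apply: f1; rewrite /= in_itv/= ap (le_trans pp pb).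
  by apply: f2; rewrite /= in_itv/= pb (le_trans ap pp).
pose rho p := (Gamma + gamma) * q p - gamma * Gamma * N p.2 ^+ 2 - N p.1 ^+ 2.
have re1_rho : {ae mu2, forall p, triangle a b tau p -> re1 p.1 p.2 = rho p}.
  apply: filterS fg2 => p /[apply] -[f1 f2].
  by rewrite /re1 scalar_re_ip_expand// f1 f2.
have rho_ge0 : {ae mu2, forall p, triangle a b tau p -> 0 <= rho p}.
  by apply: filterS2 re1_rho re1_ge0 => p rE r0 Wp; rewrite -rE ?r0.
pose K := `|(Gamma + gamma) / 2| + 2^-1 * `|Gamma - gamma|.
have NK : {ae mu2, forall p, triangle a b tau p -> N p.1 <= K * N p.2}.
  apply: filterS2 fg2 re1_ge0 => p f12 r0 Wp; have [f1 f2] := f12 Wp.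
  by rewrite /N -f1 -f2; apply: rnorm_le_of_center; apply/re_ge0_center/r0.
have K0 : 0 <= K by rewrite addr_ge0// mulr_ge0.
(* The pairing formula is used twice: the inner integral pairs [I] with [g x], the outer one pairs
   [I] with itself. *)
have qG : (\int[mu]_x \int[mu]_y (q (x, y))%:E = (rnorm I ^+ 2)%:E)%E.
  rewrite -(re_dotxx ip_norm) -intg; apply: eq_integral => x _.
  rewrite re_dotC -intg; apply: eq_integral => y _.
  by rewrite /q/= re_dotC.
have qN x y : `|q (x, y)| <= N x * N y.
  by rewrite mulrC; exact: normr_re_dot.
have qC x y : q (x, y) = q (y, x) by exact: re_dotC.
pose integrand_g x :=
  (((b - tau x) + gamma * Gamma * (tau x - a)) * N x ^+ 2)%:E.
have [c1 c2 c3] := triangle_integral_inequality mtau mu_tau ig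
  (fun x => rnorm_ge0 (g x)) ND mq qC qN qG K0 rho_ge0 NK.
have m_int : measurable_fun setT integrand_g.
  have mN : measurable_fun setT N by exact: strong_meas_rnorm.
  have mw : measurable_fun setT
      (fun x => ((b - tau x) + gamma * Gamma * (tau x - a)) * N x ^+ 2).
    apply: measurable_funM; last exact: measurable_funX.
    apply: measurable_funD; first exact: measurable_funB.
    by apply: measurable_funM => //; exact: measurable_funB.
  exact: (measurable_fun_EFin mw).
have int_eq : {ae mu, forall x, D x -> integrand x = integrand_g x}.
  apply: filterS fg => x /[apply] fgx.
  by rewrite /integrand /integrand_g /N fgx.
have int0 x : ~ D x -> integrand_g x = 0%E.
  by move=> Dx; rewrite /integrand_g ND// expr0n mulr0.
(* The integral for [f] over [D], and then its positive and negative parts, become integrals for [g]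
   over the whole space. *)
have -> : (\int[mu]_(s in D) integrand s = \int[mu]_x integrand_g x)%E.
  exact: complete_integral_restrict.
have -> : (\int[mu]_(s in D) integrand^\+ s = \int[mu]_x integrand_g^\+ x)%E.
  apply: complete_integral_restrict => //.
  - exact: measurable_funepos.
  - by move=> x Dx; rewrite funeposE int0// maxxx.
  - by apply: filterS int_eq => x /[apply] e; rewrite !funeposE e.
have -> : (\int[mu]_(s in D) integrand^\- s = \int[mu]_x integrand_g^\- x)%E.
  apply: complete_integral_restrict => //.
  - exact: measurable_funeneg.
  - by move=> x Dx; rewrite funenegE int0// oppe0 maxxx.
  - by apply: filterS int_eq => x /[apply] e; rewrite !funenegE e.
split; [exact: c1|exact: c2|].
apply: (iff_trans c3); split=> ae0.
  by apply: filterS2 re1_rho ae0 => p rE r0 Wp; rewrite (rE Wp); exact: r0.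
by apply: filterS2 re1_rho ae0 => p rE r0 Wp; rewrite -[LHS](rE Wp); exact: r0.
Qed.

Let lhs2 t s := rnorm (f t - of_real k ((Gamma + gamma) / 2) *: f s).
Let rhs2 s := 2^-1 * `|Gamma - gamma| * rnorm (f s).

Lemma pushforward_integral_inequality :
  let lhs3 := (\int[mu]_(s in D) integrand s)%E in
  let rhs3 := (Gamma + gamma) / 2 * rnorm (bochner_integral mu D f) ^+ 2 in
  let cond1 :=
    {ae mu2, forall p, triangle a b tau p -> 0 <= re1 p.1 p.2} in
  let cond2 :=
    {ae mu2, forall p, triangle a b tau p -> lhs2 p.1 p.2 <= rhs2 p.2} in
  let eq1 := {ae mu2, forall p, triangle a b tau p -> re1 p.1 p.2 = 0} in
  let eq2 :=
    {ae mu2, forall p, triangle a b tau p -> lhs2 p.1 p.2 = rhs2 p.2} in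
  (cond1 <-> cond2) /\
  (cond1 \/ cond2 ->
   [/\ ((\int[mu]_(s in D) (integrand^\+ s)) +?
          - (\int[mu]_(s in D) (integrand^\- s)))%E,
       (lhs3 <= rhs3%:E)%E,
       lhs3 = rhs3%:E <-> eq1 &
       lhs3 = rhs3%:E <-> eq2]).
Proof.
move=> lhs3 rhs3 cond1 cond2 eq1 eq2.
have cond12 : cond1 <-> cond2.
  by split; apply: filterS => p /[apply] /(re_ge0_center ip_norm).
have eq12 : eq1 <-> eq2.
  by split; apply: filterS => p /[apply] /(re_eq0_center ip_norm).
split=> // c; have {c}c1 : cond1 by case: c => // /cond12.
have [d1 d2 d3] := re1_integral_inequality c1.
by split => //; apply: (iff_trans d3).
Qed.

End pushforward.

Theorem theorem5 (R : realType) (k : scalar_kind)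
    (H : completeNormedModType (scalar R k))
    (ip : {dot H for @scalar_conj R k})
    (ip_norm : forall x : H, ip x x = `|x| ^+ 2)
    (a b : R) (le_ab : a <= b) (f : R -> H)
    (f_int : bochner_integrable leb `[a, b] f) (gamma Gamma : R) :
  let re1 (t s : R) : R :=
    scalar_re (ip (of_real k Gamma *: f s - f t)
                  (f t - of_real k gamma *: f s)) in
  let lhs2 (t s : R) : R :=
    rnorm (f t - of_real k ((Gamma + gamma) / 2) *: f s) in
  let rhs2 (s : R) : R := 2^-1 * `|Gamma - gamma| * rnorm (f s) in
  let integrand3 (s : R) : \bar R :=
    (((b - s) + gamma * Gamma * (s - a)) * rnorm (f s) ^+ 2)%:E in
  let lhs3 : \bar R := (\int[leb]_(s in `[a, b]) integrand3 s)%E in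
  let rhs3 : R :=
    (Gamma + gamma) / 2 * rnorm (bochner_integral leb `[a, b] f) ^+ 2 in
  let cond1 := {ae leb2, forall p, Delta a b p -> 0 <= re1 p.1 p.2} in
  let cond2 := {ae leb2, forall p, Delta a b p -> lhs2 p.1 p.2 <= rhs2 p.2} in
  let eq1 := {ae leb2, forall p, Delta a b p -> re1 p.1 p.2 = 0} in
  let eq2 := {ae leb2, forall p, Delta a b p -> lhs2 p.1 p.2 = rhs2 p.2} in
  (cond1 <-> cond2) /\
  (cond1 \/ cond2 ->
   [/\ (* the two parts of the integral are not both infinite *)
       ((\int[leb]_(s in `[a, b]) (integrand3^\+ s)) +?
          - (\int[leb]_(s in `[a, b]) (integrand3^\- s)))%E,
       (lhs3 <= rhs3%:E)%E,
       lhs3 = rhs3%:E <-> eq1 &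
       lhs3 = rhs3%:E <-> eq2]).
Proof.
(* With [tau] the identity, the preimages and [triangle] reduce to intervals and [Delta], so the two
   statements agree by conversion. *)
exact (@pushforward_integral_inequality _
  (caratheodory_type ((@wlength R idfun)^*)%mu) R k H ip ip_norm
  completed_lebesgue_measure a b idfun completed_lebesgue_measure_is_complete
  le_ab (@leb_measurable_id R) (fun x y _ xy _ => leb_itvcc xy) f gamma Gamma
  f_int).
Qed.
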